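(* (Kauffman's Clock Theorem for prime links.) If $G$ is a prime link diagram and $e$ is an edge of $G$, then the directed graph $\mathrm{Kauff}(G,e)$ is (the directed graph of) a graded distributive lattice.
   Context: A (connected) link diagram is regarded as a finite connected planar graph $G=(V_G,E_G)$ embedded in the oriented sphere $S^2$ in which every vertex (crossing) has degree $4$; $G$ has no loops (standing assumption), multiple edges are allowed, and $F_G$ is the set of faces. The diagram is prime if it is not a (non-trivial) connected sum: every simple closed curve in $S^2$ that meets $G$ transversally in exactly two points, both interior to edges, bounds a disk containing no vertex of $G$. An angle at a vertex $v$ is a pair of half-edges at $v$ that are consecutive in the clockwise cyclic order around $v$; it is oriented clockwise, from its source edge to its target edge (the next edge clockwise), and lies in one face. $A_G$ is the set of angles, $A_G(v)$ and $A_G(f)$ those at the vertex $v$, resp. in the face $f$. Every edge is the source of exactly two angles (one at each endpoint) and the target of exactly two angles (one at each endpoint). Let $f_1,f_2$ be the two faces adjacent to $e$. A Kauffman state of $G$ relative to $e$ is a subset $K\subset A_G$ such that $|A_G(v)\cap K|=1$ for every vertex $v$ and $|A_G(f)\cap K|=1$ for every face $f\in F_G\setminus\{f_1,f_2\}$, and $K$ has no angle in $f_1$ or $f_2$ (this is automatic for connected diagrams, since $|V_G|=|F_G|-2$). A Kauffman counterclockwise move along an edge $e'\ne e$ can be performed on $K$ when $K$ contains both angles having $e'$ as source; it replaces each of these two angles by the angle immediately following it in the counterclockwise cyclic order at the same vertex (i.e. by the two angles having $e'$ as target). The result is again a Kauffman state relative to $e$. $\mathrm{Kauff}(G,e)$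 is the directed graph whose vertices are the Kauffman states of $G$ relative to $e$ and whose arrows $K\to K'$ correspond to the counterclockwise moves. A directed graph is ''the directed graph of a graded distributive lattice'' if the relation ''$x\le y$ iff there is a directed path from $x$ to $y$'' is a partial order making its vertex set a distributive lattice, with an integer-valued rank function increasing by $1$ along each directed edge. *)

(* Defs.v *)
From HB Require Import structures.
From mathcomp Require Import all_boot all_order all_algebra all_fingroup.

Set Implicit Arguments.
Unset Strict Implicit.
Unset Printing Implicit Defensive.

(** A connected graph embedded in the oriented sphere is encoded, up to
    orientation-preserving homeomorphism, by its rotation system: [next_cw]
    sends a half-edge to the next one clockwise around its vertex, and
    [other_half] sends a half-edge to the other half of its edge.  Vertices and
    edges are the orbits of [next_cw] and [other_half].

    The angle [(d, next_cw d)] is represented by its source half-edge [d], so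
    the type [half_edge] also serves as the set of angles.  The face containing
    this angle lies on the right of the edge of [d] when walking away from the
    vertex of [d]; at the other endpoint its next angle is the one with
    _target_ half-edge [other_half d], so with source half-edge
    [next_cw^-1 (other_half d)].  Hence the faces are the orbits of
    [d |-> next_cw^-1 (other_half d)] on angles.  The embedding surface of a
    connected map is a sphere exactly when Euler's formula
    [#V - #E + #F = 2] holds. *)
Record link_diagram := LinkDiagram {
  half_edge : finType;
  next_cw : {perm half_edge};
  other_half : {perm half_edge};
  other_halfK : involutive other_half;
  other_half_neq : forall d, other_half d != d;
  next_cw_degree4 : forall d, #|porbit next_cw d| = 4;
  loopless : forall d, other_half d \notin porbit next_cw d;
  diagram_connected : forall d d',
    connect [rel x y | (y == next_cw x) || (y == other_half x)] d d';
  diagram_planar :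
    #|porbits next_cw| + #|porbits (other_half * next_cw^-1)%g|
      = #|porbits other_half| + 2
}.

Section Diagram.

Variable G : link_diagram.
Implicit Types (d : half_edge G) (v e f : {set half_edge G}).
Implicit Types (K : {set half_edge G}) (S : {set {set half_edge G}}).

Definition next_in_face : {perm half_edge G} := (other_half G * (next_cw G)^-1)%g.

Definition vertex_of d := porbit (next_cw G) d.
Definition edge_of d := porbit (other_half G) d.
Definition face_of d := porbit next_in_face d.

Definition vertices := porbits (next_cw G).
Definition edges := porbits (other_half G).
Definition faces := porbits next_in_face.

(** A closed curve meeting the diagram transversally in two points, interior
    to edges, crosses the edge of some [d1] from the face of [d1] to the face
    of [other_half d1], and then the edge of some [d2] from the face of [d2]
    back to the face of [d1].  Faces being open disks, [d1] and [d2] determine the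
    curve up to isotopy.  The edges of [d1] and [d2] may coincide. *)
Definition two_point_curve d1 d2 : Prop :=
  face_of (other_half G d1) = face_of d2 /\ face_of (other_half G d2) = face_of d1.

(** [S] is the set of vertices in one of the two disks bounded by the curve:
    the endpoints of an edge are on different sides exactly when the curve
    crosses that edge an odd number of times.  As the diagram is connected,
    this determines [S] up to exchanging the two disks. *)
Definition side_of_curve d1 d2 S : Prop :=
  S \subset vertices /\
  forall d, (vertex_of d \in S) (+) (vertex_of (other_half G d) \in S)
          = (edge_of d == edge_of d1) (+) (edge_of d == edge_of d2).

Definition prime_diagram : Prop :=
  forall d1 d2 S, two_point_curve d1 d2 -> side_of_curve d1 d2 S ->
    S = set0 \/ S = vertices.

Definition adjacent f e : bool := [exists d in e, d \in f].

(** Through the encoding of angles by their source half-edges, the angles at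
    [v] are the elements of the orbit [v], and those in [f] the elements of
    the orbit [f]. *)
Definition is_kauffman_state e K : bool :=
  [&& [forall v in vertices, #|v :&: K| == 1],
      [forall f in faces, ~~ adjacent f e ==> (#|f :&: K| == 1)]
    & [forall f in faces, adjacent f e ==> (f :&: K == set0)]].

Definition kauffman_state e := {K : {set half_edge G} | is_kauffman_state e K}.

(** The source edge of the angle [(a, next_cw a)] is [edge_of a]. *)
Definition angles_with_source e' : {set half_edge G} :=
  [set a | edge_of a == e'].

(** The angle following [(a, next_cw a)] counterclockwise is
    [(next_cw^-1 a, a)]. *)
Definition ccw_move e' K : {set half_edge G} :=
  (K :\: angles_with_source e') :|:
  [set ((next_cw G)^-1)%g a | a in angles_with_source e'].

Definition Kauff e : rel (kauffman_state e) :=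
  fun K K' : kauffman_state e => [exists e' in edges,
    [&& e' != e, angles_with_source e' \subset val K
      & val K' == ccw_move e' (val K)]].

End Diagram.

(** Lattices are nonempty by convention.  The existence of [h] says that
    reachability is an order making the vertex set [T] itself a distributive
    lattice, the structure being transported from [L]. *)
Definition graded_distributive_lattice_digraph (T : finType) (r : rel T) : Prop :=
  [/\ 0 < #|T|,
      exists (disp : Order.disp_t) (L : distrLatticeType disp) (h : T -> L),
        bijective h /\ forall x y, connect r x y = (h x <= h y)%O
    & exists rank : T -> int,
        forall x y, r x y -> rank y = (rank x + 1)%R].

(* Main.v *)
(** The angles are the edges of the overlay graph, whose vertices are the
    vertices and faces of [G] and whose faces are quadrilaterals, one for each
    edge of [G]; Kauffman states are perfect matchings of the overlay graph
    with the two faces at [e] removed.  As the surface is a sphere, two states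
    differ by the coboundary of an integer height on the edges of [G], unique
    once it vanishes at [e].  Relative to a fixed state, the heights of states
    are exactly the functions satisfying a two-sided bound on their increment
    across each angle, so they are closed under pointwise minimum and maximum
    and form a distributive lattice; a move along [e'] adds 1 to the height at
    [e'].

    Primality gives a strict Hall inequality: if all the vertices of the faces
    in [Phi] belong to a proper nonempty vertex set [S], then
    [#|Phi| < #|S|].  Indeed, when [S] is connected, the boundaries of the
    faces in [Phi] are independent in the cycle space of the subgraph induced
    on [S], which has dimension [1 + #|S| - c/2] for [c] the number of edges
    leaving [S], and [c >= 4] because [c] is even, positive and, by primality,
    different from 2.  With Hall's theorem this yields a state; it also forbids
    a closed curve in the overlay graph separating vertices from faces along
    angles outside the state, which is what would prevent a move at all the
    edges where the height is maximal. *)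
From HB Require Import structures.
Require Import Defs.
From mathcomp Require Import all_boot all_order all_algebra all_fingroup.
From mathcomp Require Import zify ring lra.

Set Implicit Arguments.
Unset Strict Implicit.
Unset Printing Implicit Defensive.

Import Order.TTheory GRing.Theory Num.Theory.

(** * Incidence matrices *)

Section Incidence.

Local Open Scope ring_scope.
Variables (F : fieldType) (TA TB : finType) (A : {pred TA}) (B : {pred TB}).
Implicit Types (f : TA -> TB -> F).

Definition incidence_mx f : 'M[F]_(#|A|, #|B|) :=
  \matrix_(i, j) f (enum_val i) (enum_val j).

Definition fun_rV (x : TA -> F) : 'rV[F]_#|A| := \row_i x (enum_val i).

Lemma fun_rV_mul f x j :
  (fun_rV x *m incidence_mx f) 0 j = \sum_(a in A) x a * f a (enum_val j).
Proof.
rewrite mxE [RHS]big_enum_val /=.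
by apply: eq_bigr => i _; rewrite !mxE.
Qed.

Lemma fun_rV_surj (v : 'rV[F]_#|A|) : exists x, v = fun_rV x.
Proof.
case: (pickP A) => [a0 Aa0 | A0]; last first.
  exists (fun _ => 0); apply/rowP => i.
  by have := enum_valP i; rewrite unfold_in A0.
exists (fun a => v 0 (enum_rank_in Aa0 a)); apply/rowP => i.
by rewrite mxE enum_valK_in.
Qed.

Lemma rank_incidence_inj f :
    (forall x, (forall b, b \in B -> \sum_(a in A) x a * f a b = 0) ->
       forall a, a \in A -> x a = 0) ->
  \rank (incidence_mx f) = #|A|.
Proof.
move=> injf; apply/eqP/inj_row_free => v; have [x ->] := fun_rV_surj v.
move=> vf0; apply/rowP => i; rewrite !mxE; apply: injf (enum_valP i) => b Bb.
have /rowP/(_ (enum_rank_in Bb b)) := vf0.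
by rewrite fun_rV_mul mxE enum_rankK_in.
Qed.

(** An extra column reading off the coordinate at [a0] makes the rows independent, and one column
    raises the rank by at most 1: the left kernel is at most a line. *)
Lemma rank_incidence_kernel_line f a0 : a0 \in A ->
    (forall x, (forall b, b \in B -> \sum_(a in A) x a * f a b = 0) ->
       x a0 = 0 -> forall a, a \in A -> x a = 0) ->
  (#|A| <= (\rank (incidence_mx f)).+1)%N.
Proof.
move=> Aa0 injf; pose c : 'cV[F]_#|A| := delta_mx (enum_rank_in Aa0 a0) 0.
have fr : row_free (row_mx (incidence_mx f) c).
  apply/inj_row_free => v; have [x ->] := fun_rV_surj v.
  rewrite mul_mx_row -row_mx0 => /eq_row_mx[vf0 vc0].
  apply/rowP => i; rewrite !mxE; apply: injf (enum_valP i) => [b Bb|].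
    have /rowP/(_ (enum_rank_in Bb b)) := vf0.
    by rewrite fun_rV_mul mxE enum_rankK_in.
  have /rowP/(_ 0) := vc0.
  rewrite mxE (bigD1 (enum_rank_in Aa0 a0)) //= big1 => [|j jN].
    by rewrite !mxE !eqxx mulr1 addr0 enum_rankK_in.
  by rewrite !mxE (negPf jN) mulr0.
rewrite -{1}(eqP fr) -mxrank_tr tr_row_mx -addsmxE.
apply: leq_trans (mxrank_adds_leqif _ _) _.
rewrite !mxrank_tr; apply: leq_trans (leq_add (leqnn _) (rank_leq_col c)) _.
by rewrite addn1.
Qed.

End Incidence.

(** * Three-term complexes: dimension bound and exactness *)

Section Complexes.

Local Open Scope ring_scope.
Variables (F : fieldType) (TA TB TC : finType).
Variables (A : {pred TA}) (B : {pred TB}) (C : {pred TC}).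
Variables (f : TA -> TB -> F) (g : TB -> TC -> F) (c0 : TC).

Hypothesis fg0 : forall a c, a \in A -> c \in C ->
  \sum_(b in B) f a b * g b c = 0.
Hypothesis Cc0 : c0 \in C.
Hypothesis kerg : forall u : TC -> F,
  (forall b, b \in B -> \sum_(c in C) g b c * u c = 0) ->
  u c0 = 0 -> forall c, c \in C -> u c = 0.

Lemma incidence_mx_comp0 : incidence_mx A B f *m incidence_mx B C g = 0.
Proof.
apply/matrixP => i j; rewrite mxE mxE.
apply: etrans (fg0 (enum_valP i) (enum_valP j)); rewrite [RHS]big_enum_val /=.
by apply: eq_bigr => k _; rewrite !mxE.
Qed.

Lemma rank_coincidence : (#|C| <= (\rank (incidence_mx B C g)).+1)%N.
Proof.
rewrite -mxrank_tr.
have -> : (incidence_mx B C g)^T = incidence_mx C B (fun c b => g b c).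
  by apply/matrixP => i j; rewrite !mxE.
apply: (rank_incidence_kernel_line Cc0) => u ug0; apply: kerg => b Bb.
by rewrite -[RHS](ug0 b Bb); apply: eq_bigr => c _; rewrite mulrC.
Qed.

(** The row space of [f] has dimension [#|A|] and lies in the kernel of [g], of dimension at most
    [#|B| - #|C| + 1]. *)
Lemma card_complex_le :
    (forall x, (forall b, b \in B -> \sum_(a in A) x a * f a b = 0) ->
       forall a, a \in A -> x a = 0) ->
  (#|A| + #|C| <= #|B|.+1)%N.
Proof.
move=> /rank_incidence_inj rf; have := mulmx0_rank_max incidence_mx_comp0.
rewrite rf => le; apply: leq_trans (leq_add (leqnn _) rank_coincidence) _.
by rewrite addnS ltnS.
Qed.

(** The two ranks are at least [#|A| - 1] and [#|C| - 1], so their sum reaches [#|B|]; with a zero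
    composite this leaves no room between image and kernel. *)
Lemma complex_exact a0 : a0 \in A ->
    (forall x, (forall b, b \in B -> \sum_(a in A) x a * f a b = 0) ->
       x a0 = 0 -> forall a, a \in A -> x a = 0) ->
    (#|A| + #|C| = #|B| + 2)%N ->
  forall y : TB -> F,
    (forall c, c \in C -> \sum_(b in B) y b * g b c = 0) ->
  exists x, forall b, b \in B -> y b = \sum_(a in A) x a * f a b.
Proof.
move=> Aa0 /(rank_incidence_kernel_line Aa0) rf cardE y yg0.
have rg := rank_coincidence.
have fker : (incidence_mx A B f <= kermx (incidence_mx B C g))%MS.
  by apply/sub_kermxP/incidence_mx_comp0.
have kerf : (kermx (incidence_mx B C g) <= incidence_mx A B f)%MS.
  rewrite -(geq_leqif (mxrank_leqif_sup fker)) mxrank_ker.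
  have := rank_leq_row (incidence_mx B C g); lia.
have : (fun_rV B y <= kermx (incidence_mx B C g))%MS.
  apply/sub_kermxP/rowP => j; rewrite fun_rV_mul mxE.
  exact/yg0/enum_valP.
case/(submx_trans)/(_ kerf)/submxP => v; have [x ->] := fun_rV_surj v.
move=> yE; exists x => b Bb; have /rowP/(_ (enum_rank_in Bb b)) := yE.
by rewrite fun_rV_mul mxE enum_rankK_in.
Qed.

End Complexes.

(** * Hall's marriage theorem *)

Section Hall.

Variables (TA TB : finType).
Implicit Types (r : {set TA * TB}) (X Y : {set TA}).

Definition neighbours r X : {set TB} := [set b | [exists a in X, (a, b) \in r]].

Definition hall_condition r := [forall X : {set TA}, #|X| <= #|neighbours r X|].

Lemma neighboursU r X Y :
  neighbours r (X :|: Y) = neighbours r X :|: neighbours r Y.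
Proof.
apply/setP => b; rewrite !inE; apply/exists_inP/orP => [[a]|[] /exists_inP[a aX ab]].
- by rewrite inE => /orP[aX|aY] ab; [left|right]; apply/exists_inP; exists a.
- by exists a => //; rewrite inE aX.
- by exists a => //; rewrite inE aX orbT.
Qed.

(* Rado's argument: in a minimal relation satisfying Hall's condition every
   point has a single neighbour, by submodularity of [#|neighbours r X|]. *)
Lemma hall_minimal_functional r : minset hall_condition r ->
  forall a b b', (a, b) \in r -> (a, b') \in r -> b = b'.
Proof.
case/minsetP => /forallP hr minr a b b' rab rab'; apply: contraTeq isT => bN.
(* By minimality, deleting [(a, c)] breaks Hall's condition at some set; it contains [a], since
   other sets keep their neighbours. [X] is this set without [a]. *)
have del c : (a, c) \in r -> exists2 X : {set TA}, a \notin X &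
    #|neighbours (r :\ (a, c)) (a |: X)| <= #|X|.
  move=> rac; have : ~~ hall_condition (r :\ (a, c)).
    apply/negP => /minr /(_ (subD1set _ _)) E.
    by move: rac; rewrite -E setD11.
  rewrite negb_forall => /existsP[Y]; rewrite -ltnNge => ltY.
  have aY : a \in Y.
    apply: contraLR ltY => aNY; rewrite -leqNgt.
    apply: leq_trans (hr Y) _; apply/subset_leq_card/subsetP => d.
    rewrite !inE => /exists_inP[a' a'Y r'd]; apply/exists_inP; exists a' => //.
    rewrite !inE r'd andbT xpair_eqE; apply: contraNN aNY => /andP[/eqP <- _] //.
  exists (Y :\ a); first by rewrite setD11.
  by rewrite setD1K // -ltnS; apply: leq_trans ltY _; rewrite (cardsD1 a Y) aY.
have [X aX ltX] := del b rab; have [Y aY ltY] := del b' rab'.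
set N := neighbours _ _ in ltX; set M := neighbours _ _ in ltY.
have NU : neighbours r (a |: (X :|: Y)) \subset N :|: M.
  apply/subsetP => d; rewrite !inE => /exists_inP[a' a'XY r'd].
  have [Ea|aN] := eqVneq a' a.
    rewrite {}Ea in r'd *; have [->|dN] := eqVneq d b.
      by apply/orP; right; apply/exists_inP; exists a;
      rewrite !inE ?eqxx ?xpair_eqE ?(negPf bN) ?andbF ?r'd.
    by apply/orP; left; apply/exists_inP; exists a;
      rewrite !inE ?eqxx ?xpair_eqE ?(negPf dN) ?andbF ?r'd.
  by move: a'XY; rewrite !inE (negPf aN) /= => /orP[a1|a1]; apply/orP; [left|right];
    apply/exists_inP; exists a'; rewrite !inE ?a1 ?orbT ?xpair_eqE ?(negPf aN) ?r'd.
have NI : neighbours r (X :&: Y) \subset N :&: M.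
  apply/subsetP => d; rewrite !inE => /exists_inP[a' /setIP[a'X a'Y] r'd].
  have aN : a' != a by apply: contraNneq aX => <-.
  by apply/andP; split; apply/exists_inP; exists a';
    rewrite !inE ?a'X ?a'Y ?orbT ?xpair_eqE ?(negPf aN) ?r'd.
(* Hall's condition for the union with [a] and for the intersection gives
   [#|X| + #|Y| + 1 <= #|N| + #|M|], against [ltX] and [ltY]. *)
have := leq_trans (hr _) (subset_leq_card NU).
have := leq_trans (hr _) (subset_leq_card NI).
rewrite cardsU1 !inE (negPf aX) (negPf aY) /=.
have := cardsUI N M; have := cardsUI X Y; lia.
Qed.

(** A minimal subrelation with Hall's condition is the graph of a function; the condition on pairs
    makes this function injective. *)
Lemma hall_matching (r : TA -> TB -> bool) :
    (forall X, #|X| <= #|[set b | [exists a in X, r a b]]|) ->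
  exists2 m : TA -> TB, injective m & forall a, r a (m a).
Proof.
move=> hr; pose r0 := [set ab : TA * TB | r ab.1 ab.2].
have h0 : hall_condition r0.
  apply/forallP => X; rewrite (eq_card (B := [set b | [exists a in X, r a b]])) // => b.
  by rewrite !inE; apply: eq_existsb => a; rewrite inE.
have [q qmin qr0] := minset_exists h0.
have /forallP hq := minsetp qmin.
have one a : #|neighbours q [set a]| == 1.
  rewrite eqn_leq -{2}(cards1 a) hq andbT; apply/card_le1P => b.
  rewrite inE => /exists_inP[a' /set1P -> qab] b'.
  rewrite inE inE; apply/exists_inP/eqP => [[a'' /set1P -> qab']| ->].
    exact: hall_minimal_functional qmin _ _ _ qab' qab.
  by exists a; rewrite ?inE.
have mP a : exists b, (a, b) \in q.
  have /cards1P[b E] := one a; exists b.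
  have : b \in neighbours q [set a] by rewrite E set11.
  by rewrite inE => /exists_inP[a' /set1P -> //].
exists (fun a => xchoose (mP a)) => [a a' eqm | a]; last first.
  by have := subsetP qr0 _ (xchooseP (mP a)); rewrite inE.
apply/eqP/negPn/negP => neq; have := hq [set a; a'].
rewrite cards2 neq leqNgt ltnS => /negP[]; apply/card_le1P => b.
have nb a1 b1 : b1 \in neighbours q [set a1] -> b1 = xchoose (mP a1).
  rewrite inE => /exists_inP[a2 /set1P -> /=] /(hall_minimal_functional qmin).
  by move=> /(_ _ (xchooseP (mP a1))).
rewrite neighboursU inE => bin; have -> : b = xchoose (mP a).
  by case/orP: bin => /nb -> //.
move=> b'; rewrite [RHS]inE inE; apply/idP/eqP => [/orP[] /nb -> // |->].
by apply/orP; left; rewrite inE; apply/exists_inP; exists a;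
  [exact: set11|exact: (xchooseP (mP a))].
Qed.

End Hall.

(** * Distributive lattices of integer functions *)

Lemma distr_lattice_of_heights (T E : finType) (H : T -> E -> int) :
    (forall x y, H x =1 H y -> x = y) ->
    (forall x y, exists z, forall i, H z i = Order.min (H x i) (H y i)) ->
    (forall x y, exists z, forall i, H z i = Order.max (H x i) (H y i)) ->
  exists (disp : Order.disp_t) (L : distrLatticeType disp) (h : T -> L),
    bijective h /\
    forall x y, (h x <= h y)%O = [forall i, (H x i <= H y i)%O].
Proof.
move=> Hinj Hmin Hmax.
have minP x y : exists z, [forall i, H z i == Order.min (H x i) (H y i)].
  by have [z zE] := Hmin x y; exists z; apply/forallP => i; rewrite zE.
have maxP x y : exists z, [forall i, H z i == Order.max (H x i) (H y i)].
  by have [z zE] := Hmax x y; exists z; apply/forallP => i; rewrite zE.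
(* As [H] is injective, the chosen elements are determined by their heights, and each lattice law
   reduces to one on integers. *)
pose meet x y := xchoose (minP x y); pose join x y := xchoose (maxP x y).
have meetE x y i : H (meet x y) i = Order.min (H x i) (H y i).
  by have /forallP/(_ i)/eqP := xchooseP (minP x y).
have joinE x y i : H (join x y) i = Order.max (H x i) (H y i).
  by have /forallP/(_ i)/eqP := xchooseP (maxP x y).
pose le x y := [forall i, (H x i <= H y i)%O].
have le_def x y : le x y = (meet x y == x).
  apply/forallP/eqP => [lexy | <- i]; last by rewrite meetE ge_min lexx orbT.
  by apply: Hinj => i; rewrite meetE; apply/min_idPl.
pose mL := @Order.isMeetJoinDistrLattice.Build (Order.Disp tt tt) T le
  (fun x y => (y != x) && le x y) meet join le_def (fun _ _ => erefl).
have meetC : commutative meet by move=> x y; apply: Hinj => i; rewrite !meetE minC.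
have joinC : commutative join by move=> x y; apply: Hinj => i; rewrite !joinE maxC.
have meetA : associative meet by move=> x y z; apply: Hinj => i; rewrite !meetE minA.
have joinA : associative join by move=> x y z; apply: Hinj => i; rewrite !joinE maxA.
have joinKI y x : meet x (join x y) = x by apply: Hinj => i; rewrite meetE joinE; lia.
have meetKU y x : join x (meet x y) = x by apply: Hinj => i; rewrite joinE meetE; lia.
have meetUl : left_distributive meet join.
  by move=> x y z; apply: Hinj => i; rewrite !(meetE, joinE); lia.
have meetxx : idempotent_op meet by move=> x; apply: Hinj => i; rewrite meetE minxx.
pose L : distrLatticeType _ :=
  HB.pack T (mL meetC joinC meetA joinA joinKI meetKU meetUl meetxx).
by exists _, L, id; split; [exists id|].
Qed.

(** * Potentials on the edges, vertices and faces of a diagram *)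

Section Orbits.

Variables (T : finType) (s : {perm T}).

Lemma porbit_permE x : porbit s (s x) = porbit s x.
Proof. by apply/eqP; rewrite eq_porbit_mem (mem_porbit s 1). Qed.

Lemma mem_porbits O x : O \in porbits s -> (x \in O) = (porbit s x == O).
Proof. by case/imsetP=> y _ ->; rewrite eq_porbit_mem. Qed.

Lemma porbit_in x : porbit s x \in porbits s.
Proof. exact: imset_f. Qed.

Lemma card_porbits_uniform n :
  (forall x, #|porbit s x| = n) -> #|T| = #|porbits s| * n.
Proof.
move=> card_n; rewrite -sum_nat_const -[LHS]sum1_card.
rewrite (partition_big (porbit s) (mem (porbits s))) => [|x _]; last exact: porbit_in.
apply: eq_bigr => O OP; have /imsetP[x _ EO] := OP.
rewrite -(card_n x) -EO -sum1_card; apply: eq_bigl => y.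
by rewrite (mem_porbits _ OP).
Qed.

Lemma sum_porbit_shift (R : nmodType) O (F : T -> R) : O \in porbits s ->
  (\sum_(x in O) F (s x) = \sum_(x in O) F x)%R.
Proof.
move=> OP; rewrite [RHS](reindex_inj (@perm_inj _ s)) /=.
by apply: eq_bigl => x; rewrite !(mem_porbits _ OP) porbit_permE.
Qed.

End Orbits.

Lemma sum_delta (R : pzRingType) (T : finType) (A : {pred T}) (x : T -> R) a :
  a \in A -> (\sum_(b in A) x b * (b == a)%:R = x a)%R.
Proof.
move=> Aa; rewrite (bigD1 a) //= eqxx mulr1 big1 ?addr0 // => b /andP[_ /negPf ->].
by rewrite mulr0.
Qed.

Section Diagram.

Variable G : link_diagram.
Implicit Types (d a b : half_edge G) (v e f : {set half_edge G}).

Local Notation s := (next_cw G).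
Local Notation t := (other_half G).
Local Notation p := (next_in_face G).
Local Notation vx := (@vertex_of G).
Local Notation ed := (@edge_of G).
Local Notation fc := (@face_of G).

Lemma other_half_other_half d : t (t d) = d. Proof. exact: other_halfK. Qed.

Lemma next_cw_next_in_face d : s (p d) = t d.
Proof. by rewrite permM permKV. Qed.

Lemma vertex_of_next_cw d : vx (s d) = vx d. Proof. exact: porbit_permE. Qed.
Lemma edge_of_other_half d : ed (t d) = ed d. Proof. exact: porbit_permE. Qed.
Lemma face_of_next d : fc (p d) = fc d. Proof. exact: porbit_permE. Qed.

Lemma vertex_of_next_in_face d : vx (p d) = vx (t d).
Proof. by rewrite -next_cw_next_in_face vertex_of_next_cw. Qed.

(** Consecutive angles of a face share an edge, the source of [d] and the target of the next angle;
    this makes sums around faces cancel. *)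
Lemma edge_of_cw_face d : ed (s (p d)) = ed d.
Proof. by rewrite next_cw_next_in_face edge_of_other_half. Qed.

Lemma edge_ofE d : ed d = [set d; t d].
Proof.
apply/setP => x; rewrite !inE; apply/idP/orP => [/porbitP[i ->]|[]/eqP ->].
- elim: i => [|i []/eqP IH]; first by left; rewrite perm1.
    by right; rewrite expgSr permM IH.
  by left; rewrite expgSr permM IH other_half_other_half.
- exact: porbit_id.
- exact: (mem_porbit (other_half G) 1).
Qed.

Lemma edge_of_eq a b : (ed a == ed b) = (a == b) || (a == t b).
Proof. by rewrite eq_porbit_mem -/(ed b) edge_ofE !inE. Qed.

Lemma connected_constant (T : eqType) (u : half_edge G -> T) :
    (forall d, u (s d) = u d) -> (forall d, u (t d) = u d) ->
  forall d d', u d = u d'.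
Proof.
move=> us ut d d'; have /connectP[l pl ->] := diagram_connected d d'.
elim: l d pl => [|x l IH] d //= /andP[dx /IH <-].
by case/orP: dx => /eqP ->.
Qed.

Lemma card_half_edge4 : #|half_edge G| = #|vertices G| * 4.
Proof. by apply: card_porbits_uniform => d; apply: next_cw_degree4. Qed.

Lemma card_half_edge2 : #|half_edge G| = #|edges G| * 2.
Proof.
apply: card_porbits_uniform => d.
by rewrite -/(edge_of d) edge_ofE cards2 eq_sym other_half_neq.
Qed.

Lemma card_faces : #|faces G| = #|vertices G| + 2.
Proof.
have := diagram_planar G.
rewrite -/(next_in_face G) -/(vertices G) -/(edges G) -/(faces G).
have := card_half_edge4; rewrite card_half_edge2; lia.
Qed.

(** * The complex of edges, angles and cells *)

Definition cell_pred : {pred {set half_edge G} + {set half_edge G}} :=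
  fun c => match c with inl v => v \in vertices G | inr f => f \in faces G end.

Local Open Scope ring_scope.

(** Coefficients are rational because dimensions are compared over a field. *)
Definition edge_coboundary e a : rat := (e == ed (s a))%:R - (e == ed a)%:R.

Definition angle_boundary a (c : {set half_edge G} + {set half_edge G}) : rat :=
  match c with inl v => (v == vx a)%:R | inr f => - (f == fc a)%:R end.

(** Euler's formula for the overlay graph. *)
Lemma card_cells : (#|edges G| + #|cell_pred| = #|half_edge G| + 2)%N.
Proof.
have -> : #|cell_pred| = (#|vertices G| + #|faces G|)%N.
  rewrite -!sum1_card big_sumType /=; congr addn; exact: eq_bigl.
by rewrite card_faces; have := card_half_edge4; rewrite card_half_edge2; lia.
Qed.

Lemma sum_edge_coboundary (x : {set half_edge G} -> rat) a :
  \sum_(e in edges G) x e * edge_coboundary e a = x (ed (s a)) - x (ed a).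
Proof.
under eq_bigr => e _ do rewrite mulrBr.
by rewrite sumrB !sum_delta ?porbit_in.
Qed.

Lemma sum_angle_boundary (u : {set half_edge G} + {set half_edge G} -> rat) a :
  \sum_(c in cell_pred) u c * angle_boundary a c = u (inl (vx a)) - u (inr (fc a)).
Proof.
rewrite big_sumType /=; congr (_ + _); first by rewrite sum_delta ?porbit_in.
under eq_bigr => f _ do rewrite mulrN.
by rewrite sumrN sum_delta ?porbit_in.
Qed.

Lemma sum_angle_vertex (y : half_edge G -> rat) v : v \in vertices G ->
  \sum_a y a * angle_boundary a (inl v) = \sum_(a in v) y a.
Proof.
move=> vV; rewrite [RHS]big_mkcond; apply: eq_bigr => a _ /=.
by rewrite (mem_porbits _ vV) -/(vertex_of a) eq_sym mulr_natr mulrb.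
Qed.

Lemma sum_angle_face (y : half_edge G -> rat) f : f \in faces G ->
  \sum_a y a * angle_boundary a (inr f) = - \sum_(a in f) y a.
Proof.
move=> fF; rewrite [in RHS]big_mkcond -sumrN; apply: eq_bigr => a _ /=.
by rewrite (mem_porbits _ fF) -/(face_of a) eq_sym mulrN mulr_natr mulrb.
Qed.

(** Around a vertex or a face, each edge is the source of as many angles as it is the target of. *)
Lemma coboundary_boundary e c : c \in cell_pred ->
  \sum_a edge_coboundary e a * angle_boundary a c = 0.
Proof.
case: c => [v vV|f fF].
  rewrite sum_angle_vertex // sumrB.
  by rewrite (sum_porbit_shift (fun a => (e == ed a)%:R) vV) subrr.
rewrite sum_angle_face // sumrB -(sum_porbit_shift (fun a => (e == ed (s a))%:R) fF).
by under eq_bigr => a _ do rewrite edge_of_cw_face; rewrite subrr oppr0.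
Qed.

Lemma constant_on_edges (T : eqType) (x : {set half_edge G} -> T) :
    (forall a, x (ed (s a)) = x (ed a)) -> forall a b, x (ed a) = x (ed b).
Proof.
move=> xs; apply: connected_constant => d //.
by rewrite edge_of_other_half.
Qed.

Lemma constant_on_cells (T : eqType) (rv rf : {set half_edge G} -> T) :
    (forall a, rv (vx a) = rf (fc a)) ->
  forall a b, rv (vx a) = rv (vx b).
Proof.
move=> rvf; apply: connected_constant => d; first by rewrite vertex_of_next_cw.
by rewrite -vertex_of_next_in_face !rvf face_of_next.
Qed.

Lemma edge_coboundary_kernel d0 (x : {set half_edge G} -> rat) :
    (forall a, \sum_(e in edges G) x e * edge_coboundary e a = 0) ->
    x (ed d0) = 0 -> forall e, e \in edges G -> x e = 0.
Proof.
move=> x0 xd0 _ /imsetP[d _ ->]; rewrite -xd0.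
apply: (constant_on_edges (x := x)) => a; apply/eqP.
by rewrite -subr_eq0 -sum_edge_coboundary x0.
Qed.

Lemma angle_boundary_kernel d0 (u : {set half_edge G} + {set half_edge G} -> rat) :
    (forall a, \sum_(c in cell_pred) u c * angle_boundary a c = 0) ->
    u (inl (vx d0)) = 0 -> forall c, c \in cell_pred -> u c = 0.
Proof.
move=> u0 ud0; have uvf a : u (inl (vx a)) = u (inr (fc a)).
  by apply/eqP; rewrite -subr_eq0 -sum_angle_boundary u0.
case=> _ /imsetP[d _ ->]; rewrite -ud0 -?uvf;
  exact: (constant_on_cells (rv := u \o inl) (rf := u \o inr)).
Qed.

(* Exactness of the complex edges -> angles -> vertices and faces: Euler's
   formula is what makes the dimensions match. *)
Lemma edge_potential (y : half_edge G -> rat) :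
    (forall v, v \in vertices G -> \sum_(a in v) y a = 0) ->
    (forall f, f \in faces G -> \sum_(a in f) y a = 0) ->
  exists x : {set half_edge G} -> rat, forall a, y a = x (ed (s a)) - x (ed a).
Proof.
move=> yv yf; case: (pickP (half_edge G)) => [d0 _ | noD]; last first.
  by exists (fun _ => 0) => a; have := noD a.
have [|||||||x xE] := @complex_exact _ _ _ _ (mem (edges G)) predT cell_pred
  edge_coboundary angle_boundary (inl (vx d0)) _ _ _ (ed d0) _ _ _ y.
- by move=> e c _; apply: coboundary_boundary.
- exact: porbit_in.
- move=> u u0; apply: angle_boundary_kernel => a; rewrite -[RHS](u0 a isT).
  by apply: eq_bigr => c _; rewrite mulrC.
- exact: porbit_in.
- by move=> x x0; apply: edge_coboundary_kernel => a; apply: x0.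
- exact: card_cells.
- by case=> [v /[dup] vV /yv|f /[dup] fF /yf] E;
    rewrite ?sum_angle_vertex ?sum_angle_face ?E ?oppr0.
by exists x => a; rewrite xE // sum_edge_coboundary.
Qed.

(** The same complex read backwards: a flow across angles, from source to target edge, that is
    conserved at each edge is the difference of potentials on its two sides, a vertex and a face. *)
Lemma cell_potential (y : half_edge G -> rat) :
    (forall e, e \in edges G ->
       \sum_(a | ed (s a) == e) y a = \sum_(a | ed a == e) y a) ->
  exists rv rf : {set half_edge G} -> rat, forall a, y a = rv (vx a) - rf (fc a).
Proof.
move=> ye; case: (pickP (half_edge G)) => [d0 _ | noD]; last first.
  by exists (fun _ => 0), (fun _ => 0) => a; have := noD a.
have [|||||||x xE] := @complex_exact _ _ _ _ cell_pred predT (mem (edges G))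
  (fun c a => angle_boundary a c) (fun a e => edge_coboundary e a)
  (ed d0) _ _ _ (inl (vx d0)) _ _ _ y.
- move=> c e cC _; apply: etrans (coboundary_boundary e cC).
  by apply: eq_bigr => a _; rewrite mulrC.
- exact: porbit_in.
- move=> u u0; apply: edge_coboundary_kernel => a; rewrite -[RHS](u0 a isT).
  by apply: eq_bigr => c _; rewrite mulrC.
- exact: porbit_in.
- by move=> x x0; apply: angle_boundary_kernel => a; apply: x0.
- by rewrite addnC card_cells.
- move=> e /ye E; under eq_bigr => a _ do rewrite mulrBr.
  apply/eqP; rewrite sumrB subr_eq0; apply/eqP.
  move: E; rewrite big_mkcond [RHS]big_mkcond /= => E.
  under eq_bigr => a _ do rewrite mulr_natr mulrb eq_sym.
  by rewrite E; apply: eq_bigr => a _; rewrite mulr_natr mulrb eq_sym.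
by exists (x \o inl), (x \o inr) => a; rewrite xE // sum_angle_boundary.
Qed.

End Diagram.

(** * Edge cuts and the strict Hall inequality *)

Section Cuts.

Variable G : link_diagram.
Implicit Types (d a b : half_edge G) (v e f : {set half_edge G}).
Implicit Types (S Phi : {set {set half_edge G}}).

Local Notation s := (next_cw G).
Local Notation t := (other_half G).
Local Notation p := (next_in_face G).
Local Notation vx := (@vertex_of G).
Local Notation ed := (@edge_of G).
Local Notation fc := (@face_of G).

Local Open Scope ring_scope.

Lemma sum_same_edge (R : nmodType) (F : half_edge G -> R) b :
  \sum_(a | ed a == ed b) F a = F b + F (t b).
Proof.
rewrite (bigD1 b) //= (bigD1 (t b)) /=; last by rewrite edge_of_other_half eqxx other_half_neq.
rewrite big1 ?addr0 // => a; rewrite edge_of_eq => /andP[/andP[/orP[]/eqP ->]];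
  by rewrite eqxx ?andbF.
Qed.

Lemma sum_same_target_edge (R : nmodType) (F : half_edge G -> R) b :
  \sum_(a | ed (s a) == ed b) F a = F (p b) + F (p (t b)).
Proof.
rewrite -(sum_same_edge (F \o p)) (reindex_inj (@perm_inj _ p)) /=.
by apply: eq_bigl => a; rewrite edge_of_cw_face.
Qed.

Definition oriented b := (enum_rank b < enum_rank (t b))%N.

Lemma oriented_other_half b : oriented (t b) = ~~ oriented b.
Proof.
rewrite /oriented other_half_other_half -leqNgt [RHS]leq_eqVlt.
by rewrite (inj_eq (@ord_inj _)) (inj_eq enum_rank_inj) (negPf (other_half_neq b)).
Qed.

Lemma sum_oriented (R : nmodType) (P : pred (half_edge G)) (F : half_edge G -> R) :
    (forall b, P (t b) = P b) ->
  \sum_(b | P b) F b = \sum_(b | P b && oriented b) (F b + F (t b)).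
Proof.
move=> Pt; rewrite (bigID oriented) /= big_split /=; congr (_ + _).
rewrite (reindex_inj (@perm_inj _ t)) /=.
by apply: eq_bigl => b; rewrite Pt oriented_other_half negbK.
Qed.

Definition inner S b := (vx b \in S) && (vx (t b) \in S).
Definition outgoing S : {set half_edge G} :=
  [set b | (vx b \in S) && (vx (t b) \notin S)].

Lemma inner_other_half S b : inner S (t b) = inner S b.
Proof. by rewrite /inner other_half_other_half andbC. Qed.

(** Counts half-edges at [S]: an edge inside [S] contributes two, an edge of the cut one. *)
Lemma card_cut S : S \subset vertices G ->
  (#|[pred b | inner S b && oriented b]| * 2 + #|outgoing S| = #|S| * 4)%N.
Proof.
move=> /subsetP SV; transitivity #|[pred b | vx b \in S]|; last first.
  rewrite -sum_nat_const -[LHS]sum1_card (partition_big vx (mem S)) //=.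
  apply: eq_bigr => v vS; have /imsetP[d _ Ev] := SV _ vS.
  rewrite -(next_cw_degree4 d) -sum1_card; apply: eq_bigl => b.
  by rewrite inE -eq_porbit_mem -Ev; apply/andb_idl => /eqP ->.
rewrite -(cardID (fun b => vx (t b) \in S) [pred b | vx b \in S]); congr addn; last first.
  by apply: eq_card => b; rewrite !inE andbC.
have -> : #|[predI [pred b | vx b \in S] & fun b => vx (t b) \in S]| = #|inner S|.
  by apply: eq_card => b; rewrite !inE unfold_in.
rewrite -[RHS]sum1_card [RHS](sum_oriented (fun _ => 1%N)); last exact: inner_other_half.
by rewrite -sum_nat_const; apply: eq_bigl.
Qed.

(* If both sides of an edge were the same face, a path inside this face would
   close up to a curve crossing the diagram once, and the four half-edges at
   the vertices on one side of it could not be paired up. *)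
Lemma face_of_other_half_neq d : fc (t d) != fc d.
Proof.
apply/negP; rewrite eq_sym eq_porbit_mem => /porbitP[n dE].
(* [c] counts the visits along the face from [t d] to [d], without the starting angle. Its defects
   at the two halves of the edge of [d] cancel, so it is a conserved flow. *)
pose c x : rat := \sum_(i < n) (x == (p ^+ i.+1)%g (t d))%:R.
have cp x : c x - c (p x) = (x == d)%:R - (x == t d)%:R.
  have pE i : (p x == (p ^+ i.+1)%g (t d)) = (x == (p ^+ i)%g (t d)).
    by rewrite expgSr [X in _ == X]permM (inj_eq (@perm_inj _ p)).
  rewrite /c; under [X in _ - X]eq_bigr => i _ do rewrite pE.
  rewrite -(big_mkord predT (fun i => (x == (p ^+ i.+1)%g (t d))%:R)).
  rewrite -(big_mkord predT (fun i => (x == (p ^+ i)%g (t d))%:R)).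
  rewrite -sumrB (telescope_sumr (fun i => (x == (p ^+ i)%g (t d))%:R)) //.
  by rewrite -dE perm1.
have [|rv [rf cE]] := @cell_potential G c.
  move=> _ /imsetP[b _ ->]; rewrite sum_same_edge sum_same_target_edge.
  have := cp b; have := cp (t b); rewrite (inj_eq (@perm_inj _ t)).
  have -> : (t b == d) = (b == t d).
    by apply/eqP/eqP => [<-|->]; rewrite other_half_other_half.
  lra.
have rvE b : rv (vx b) - rv (vx (t b)) = (b == d)%:R - (b == t d)%:R.
  by rewrite -cp !cE vertex_of_next_in_face face_of_next; ring.
pose S := [set v in vertices G | rv v == rv (vx d)].
have SE b : (vx b \in S) = (rv (vx b) == rv (vx d)) by rewrite inE porbit_in.
have outE : outgoing S = [set d].
  apply/setP => b; rewrite !inE !porbit_in /=; have := rvE b.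
  have [->|bd] := eqVneq b d.
    rewrite eqxx eq_sym (negPf (other_half_neq d)) /= => E.
    by apply/negP => /eqP E'; move: E; rewrite E' /=; lra.
  have [->|_] := eqVneq b (t d).
    rewrite other_half_other_half => E; apply/negP => /andP[/eqP E' _]; move: E.
    by rewrite E' /=; lra.
  move=> E; have -> : rv (vx (t b)) = rv (vx b) by move: E; rewrite /=; lra.
  by rewrite andbN.
have SV : S \subset vertices G by apply/subsetP => v; rewrite inE => /andP[].
have := card_cut SV; rewrite outE cards1; lia.
Qed.

Lemma constant_on_faces (T : eqType) (x : {set half_edge G} -> T) :
    (forall b, x (fc b) = x (fc (t b))) -> forall a b, x (fc a) = x (fc b).
Proof.
move=> xt; apply: connected_constant => d //.
have [d' ->] : exists d', d = p d' by exists (p^-1 d)%g; rewrite permKV.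
by rewrite next_cw_next_in_face face_of_next.
Qed.

(* The boundaries of the faces in [Phi] are independent cycles of the subgraph
   induced on [S]. *)
Lemma card_faces_in_subgraph S Phi v0 b1 :
    Phi \subset faces G -> S \subset vertices G ->
    (forall b, fc b \in Phi -> vx b \in S) -> v0 \in S -> fc b1 \notin Phi ->
    (forall u : {set half_edge G} -> rat,
       (forall b, inner S b -> u (vx b) = u (vx (t b))) ->
       forall v, v \in S -> u v = u v0) ->
  (#|Phi| + #|S| <= #|[pred b | inner S b && oriented b]|.+1)%N.
Proof.
move=> /subsetP PF /subsetP SV PS v0S b1P conn.
have PhiI b : (fc b \in Phi) || (fc (t b) \in Phi) -> inner S b.
  case/orP => bP; apply/andP; split.
  - exact: PS.
  - by rewrite -vertex_of_next_in_face PS // face_of_next.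
  - by rewrite -(other_half_other_half b) -vertex_of_next_in_face PS // face_of_next.
  - exact: PS.
pose f phi b : rat := (phi == fc b)%:R - (phi == fc (t b))%:R.
pose g b v : rat := (v == vx (t b))%:R - (v == vx b)%:R.
apply: (@card_complex_le _ _ _ _ _ _ _ f g v0) => //.
- move=> phi v phiP vS.
  pose F b : rat := (phi == fc b)%:R * ((v == vx (t b))%:R - (v == vx b)%:R).
  transitivity (\sum_(b | inner S b) F b).
    rewrite (sum_oriented F); last exact: inner_other_half.
    by apply: eq_bigr => b _; rewrite /F /f /g other_half_other_half; ring.
  transitivity (\sum_(b in phi) ((v == vx (t b))%:R - (v == vx b)%:R : rat)).
    rewrite big_mkcond [RHS]big_mkcond; apply: eq_bigr => b _ /=.
    rewrite (mem_porbits _ (PF _ phiP)) -/(face_of b) eq_sym /F.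
    have [E|_] := eqVneq (fc b) phi; last by rewrite mul0r; case: ifP.
    by rewrite PhiI ?E ?phiP // mul1r.
  rewrite sumrB -(sum_porbit_shift (fun b => (v == vx b)%:R) (PF _ phiP)).
  by under [X in _ - X]eq_bigr => b _ do rewrite vertex_of_next_in_face; rewrite subrr.
- move=> u ug u0 v vS; rewrite -u0; apply: (conn u) => // b Ib.
  have uE b' : inner S b' -> \sum_(c in S) g b' c * u c = u (vx (t b')) - u (vx b').
    case/andP => b'S tb'S; under eq_bigr => c _ do rewrite mulrC mulrBr.
    by rewrite sumrB !sum_delta.
  case: (boolP (oriented b)) => ob.
    have /ug : b \in [pred b | inner S b && oriented b] by rewrite inE Ib.
    by rewrite uE // => /eqP; rewrite subr_eq0 => /eqP.
  have tI : inner S (t b) by rewrite inner_other_half.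
  have /ug : t b \in [pred b | inner S b && oriented b].
    by rewrite inE tI oriented_other_half.
  by rewrite uE // other_half_other_half => /eqP; rewrite subr_eq0 => /eqP.
(* Extended by zero outside [Phi], a relation between face boundaries is unchanged across every
   edge, hence constant; it vanishes at the face of [b1]. *)
move=> x xf phi phiP; pose x' phi := if phi \in Phi then x phi else 0.
have sumx b : \sum_(a in Phi) x a * f a b = x' (fc b) - x' (fc (t b)).
  have dE c : \sum_(a in Phi) x a * (a == c)%:R = x' c.
    rewrite /x'; case: ifP => cP; first exact: sum_delta.
    rewrite big1 // => a aP; case: eqP => [E|_]; last by rewrite mulr0.
    by rewrite -E aP in cP.
  under eq_bigr => a _ do rewrite mulrBr.
  by rewrite sumrB !dE.
have x't b : x' (fc b) = x' (fc (t b)).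
  case: (boolP (inner S b)) => [Ib|NI]; last first.
    have := contra (@PhiI b) NI; rewrite negb_or /x' => /andP[/negPf -> /negPf ->] //.
  case: (boolP (oriented b)) => ob.
    have /xf : b \in [pred b | inner S b && oriented b] by rewrite inE Ib.
    by rewrite sumx => /eqP; rewrite subr_eq0 => /eqP.
  have /xf : t b \in [pred b | inner S b && oriented b].
    by rewrite inE inner_other_half Ib oriented_other_half.
  by rewrite sumx other_half_other_half => /eqP; rewrite subr_eq0 => /eqP.
have /imsetP[b _ phiE] := PF _ phiP.
have := constant_on_faces x't b b1.
by rewrite /x' /face_of -phiE phiP => ->; rewrite -/(fc b1) (negPf b1P).
Qed.

Lemma cut_nonempty S : S \subset vertices G -> S != set0 -> S != vertices G ->
  (0 < #|outgoing S|)%N.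
Proof.
move=> /subsetP SV /set0Pn[v vS] SN; rewrite card_gt0.
apply: contraNneq SN => out0; have /imsetP[d _ Ev] := SV _ vS.
have closed b : vx b \in S -> vx (t b) \in S.
  move=> bS; apply: contraT => tbS.
  by have : b \in outgoing S; [rewrite inE bS | rewrite out0 inE].
have cst := @connected_constant G _ (fun b => vx b \in S) _ _.
rewrite eqEsubset; apply/andP; split; first exact/subsetP.
apply/subsetP => _ /imsetP[b _ ->]; rewrite -/(vx b) (cst _ _ b d) => [|c|c].
- by rewrite /vertex_of -Ev.
- by rewrite vertex_of_next_cw.
by apply/idP/idP => /closed; rewrite ?other_half_other_half.
Qed.

(** Around a face, exits from [S] balance entries. As the two sides of an edge are distinct faces,
    two cut edges would have the same two faces on their sides, and a closed curve would cross just
    these edges. *)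
Lemma prime_cut_neq2 S : prime_diagram G ->
  S \subset vertices G -> S != set0 -> S != vertices G -> #|outgoing S| != 2%N.
Proof.
move=> prG SV S0 SN; apply/negP => /cards2P[d1 [d2 [dN outE]]].
have outP b : (vx b \in S) && (vx (t b) \notin S) = (b == d1) || (b == d2).
  by have /setP/(_ b) := outE; rewrite !inE.
have eqt b c : (t b == c) = (b == t c).
  by apply/eqP/eqP => [<-|->]; rewrite other_half_other_half.
have outPt b : (vx (t b) \in S) && (vx b \notin S) = (b == t d1) || (b == t d2).
  by have := outP (t b); rewrite other_half_other_half !eqt.
have dtN : d1 != t d2.
  apply/eqP => E; have := outP d1; have := outPt d1.
  by rewrite E !eqxx !orbT; case: (vx _ \in S); rewrite ?andbF.
have dtN' : d2 != t d1 by rewrite -eqt eq_sym.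
have count (phi : {set half_edge G}) : phi \in faces G ->
    ((fc d1 == phi) + (fc d2 == phi) = (fc (t d1) == phi) + (fc (t d2) == phi))%N.
  move=> phiF.
  pose I b : int := (vx b \in S)%:R.
  have : \sum_(b in phi) (I b - I (t b)) = 0.
    rewrite sumrB -(sum_porbit_shift I phiF).
    by under eq_bigr => b _ do rewrite /I vertex_of_next_in_face; rewrite subrr.
  pose D c b : int := (b == c)%:R.
  have -> : \sum_(b in phi) (I b - I (t b)) =
      \sum_(b in phi) (D d1 b + D d2 b - (D (t d1) b + D (t d2) b)).
    apply: eq_bigr => b _; have := outP b; have := outPt b.
    rewrite /I /D; have [->|_] := eqVneq b d1.
      rewrite (negPf dN) [d1 == t d1]eq_sym (negPf (other_half_neq d1)) (negPf dtN).
      by case: (vx d1 \in S) (vx (t d1) \in S) => [] [].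
    have [->|_] := eqVneq b d2.
      rewrite [d2 == t d2]eq_sym (negPf (other_half_neq d2)) (negPf dtN').
      by case: (vx d2 \in S) (vx (t d2) \in S) => [] [].
    have [->|_] := eqVneq b (t d1).
      rewrite (inj_eq (@perm_inj _ t)) (negPf dN).
      by case: (vx _ \in S) (vx (t (t d1)) \in S) => [] [].
    have [->|_] := eqVneq b (t d2).
      by case: (vx _ \in S) (vx (t (t d2)) \in S) => [] [].
    by case: (vx b \in S) (vx (t b) \in S) => [] [].
  have sD c : \sum_(b in phi) D c b = (fc c == phi)%:R.
    rewrite -(mem_porbits _ phiF) big_mkcond (bigD1 c) //= big1 => [|b /negPf bc].
      by rewrite /D eqxx addr0; case: ifP.
    by rewrite /D bc; case: ifP.
  rewrite sumrB !big_split /= !sD => E; lia.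
have curve : two_point_curve d1 d2.
  have := count _ (porbit_in _ d1); have := count _ (porbit_in _ d2).
  rewrite -!/(fc _) !eqxx (negPf (face_of_other_half_neq d1)).
  rewrite (negPf (face_of_other_half_neq d2)) => E2 E1.
  by split; apply/eqP; lia.
have side : side_of_curve d1 d2 S.
  split=> // d; rewrite !edge_of_eq; have := outP d; have := outPt d.
  have [->|_] := eqVneq d d1.
    rewrite (negPf dN) [d1 == t d1]eq_sym (negPf (other_half_neq d1)) (negPf dtN).
    by case: (vx d1 \in S) (vx (t d1) \in S) => [] [].
  have [->|_] := eqVneq d d2.
    rewrite (negPf dtN').
    by case: (vx d2 \in S) (vx (t d2) \in S) => [] [].
  have [->|_] := eqVneq d (t d1).
    rewrite (inj_eq (@perm_inj _ t)) (negPf dN).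
    by case: (vx _ \in S) (vx (t (t d1)) \in S) => [] [].
  have [->|_] := eqVneq d (t d2).
    by case: (vx _ \in S) (vx (t (t d2)) \in S) => [] [].
  by case: (vx d \in S) (vx (t d) \in S) => [] [].
by case: (prG d1 d2 S curve side) => E; [rewrite E eqxx in S0 | rewrite E eqxx in SN].
Qed.

(** By induction on [#|S|]: if the induced subgraph is disconnected, each face of [Phi] has all its
    vertices in one part and the inequalities add up; if it is connected, its cycle space is
    counted. *)
Lemma prime_faces_lt_vertices S Phi : prime_diagram G ->
    S \subset vertices G -> S != set0 -> S != vertices G -> Phi \subset faces G ->
    (forall b, fc b \in Phi -> vx b \in S) ->
  (#|Phi| < #|S|)%N.
Proof.
move=> prG; have [n leSn] := ubnP #|S|.
elim: n => // n IH in S Phi leSn *; move=> SV S0 SN PF PS.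
case: (boolP [exists S1 : {set {set half_edge G}},
    [&& S1 \subset S, S1 != set0, S1 != S &
      [forall b, (vx b \in S1) && inner S b ==> (vx (t b) \in S1)]]]).
  case/existsP => S1 /and4P[S1S S10 S1N /forallP cl].
  pose Phi1 := [set phi in Phi | [exists b, (fc b == phi) && (vx b \in S1)]].
  (* Walking along the face stays in [S], so it cannot leave the closed part [S1]. *)
  have closed1 b : fc b \in Phi1 -> vx b \in S1.
    rewrite inE => /andP[bP /existsP[b' /andP[/eqP E b'S]]].
    move: bP; rewrite -E => b'P.
    have : b \in fc b' by rewrite E porbit_id.
    case/porbitP => i ->; elim: i => [|i IHi]; first by rewrite perm1.
    rewrite expgSr permM vertex_of_next_in_face.
    set x := (p ^+ i)%g b' in IHi *.
    have xP : fc x = fc b' by apply/eqP; rewrite eq_porbit_mem mem_porbit.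
    apply: (implyP (cl x)); rewrite IHi /inner -vertex_of_next_in_face.
    by rewrite !PS ?face_of_next ?xP.
  have closed2 b : fc b \in Phi :\: Phi1 -> vx b \in S :\: S1.
    case/setDP => bP bN; rewrite inE PS // andbT; apply: contraNN bN => bS.
    by rewrite inE bP; apply/existsP; exists b; rewrite eqxx.
  have SS1 : (#|S1| + #|S :\: S1| = #|S|)%N by rewrite -(cardsID S1 S) (setIidPr S1S).
  have P1 : Phi1 \subset Phi by apply/subsetP => x; rewrite inE => /andP[].
  have PP1 : (#|Phi1| + #|Phi :\: Phi1| = #|Phi|)%N.
    by rewrite -(cardsID Phi1 Phi) (setIidPr P1).
  have S2 : S :\: S1 != set0.
    apply: contraNneq S1N => /eqP; rewrite setD_eq0 => SS.
    by rewrite eqEsubset S1S.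
  have proper S' : S' \subset S -> S' \subset vertices G /\ S' != vertices G.
    move=> S'S; split; first exact: subset_trans SV.
    by apply: contraNneq SN => E; rewrite eqEsubset SV -E.
  have [V1 N1] := proper _ S1S; have [V2 N2] := proper _ (subsetDl S S1).
  have S1gt : (0 < #|S1|)%N by rewrite card_gt0.
  have S2gt : (0 < #|S :\: S1|)%N by rewrite card_gt0.
  have lt1 : (#|Phi1| < #|S1|)%N.
    apply: (IH S1 Phi1 _ V1 S10 N1 (subset_trans P1 PF) closed1).
    by rewrite -ltnS; apply: leq_trans leSn; rewrite ltnS -SS1 -addn1 leq_add2l.
  have lt2 : (#|Phi :\: Phi1| < #|S :\: S1|)%N.
    apply: (IH _ _ _ V2 S2 N2 (subset_trans (subsetDl _ _) PF) closed2).
    by rewrite -ltnS; apply: leq_trans leSn; rewrite ltnS -SS1 -add1n leq_add2r.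
  rewrite -SS1 -PP1 -addSn; apply: leq_add => //; exact: ltnW.
move=> noS1; have /set0Pn[v0 v0S] := S0.
have [b1 b1N] : exists b1, vx b1 \notin S.
  apply/existsP; rewrite -negb_forall; apply: contraNN SN => /forallP all.
  by rewrite eqEsubset SV; apply/subsetP => _ /imsetP[b _ ->]; apply: all.
have conn (u : {set half_edge G} -> rat) :
    (forall b, inner S b -> u (vx b) = u (vx (t b))) ->
    forall v, v \in S -> u v = u v0.
  move=> uI v vS; apply/eqP; apply: contraNT noS1 => vN.
  apply/existsP; exists [set w in S | u w == u v0]; apply/and4P; split.
  - by apply/subsetP => w; rewrite inE => /andP[].
  - by apply/set0Pn; exists v0; rewrite inE v0S eqxx.
  - by apply: contraNneq vN => /setP/(_ v); rewrite inE vS.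
  - apply/forallP => b; apply/implyP => /andP[]; rewrite inE => /andP[_ /eqP <-] Ib.
    by rewrite inE (uI _ Ib) eqxx andbT; case/andP: Ib.
have bound := card_faces_in_subgraph PF SV PS v0S (contra (PS b1) b1N) conn.
(* The cut is even, positive and not 2, so at least 4; the inner edges then number at most
   [2 * #|S| - 2]. *)
have := card_cut SV; have := cut_nonempty SV S0 SN; have := prime_cut_neq2 prG SV S0 SN.
by move/eqP; lia.
Qed.

End Cuts.

(** * Kauffman states and their heights *)

Section KauffmanStates.

Variables (G : link_diagram) (e : {set half_edge G}).
Implicit Types (d a b : half_edge G) (v f : {set half_edge G}).
Implicit Types (K : {set half_edge G}).

Local Notation s := (next_cw G).
Local Notation t := (other_half G).
Local Notation p := (next_in_face G).
Local Notation vx := (@vertex_of G).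
Local Notation ed := (@edge_of G).
Local Notation fc := (@face_of G).

Local Open Scope ring_scope.

Lemma adjacentE d f : e = ed d -> f \in faces G ->
  adjacent f e = (f == fc d) || (f == fc (t d)).
Proof.
move=> -> fF; have inF x : (x \in f) = (f == fc x).
  by rewrite (mem_porbits _ fF) eq_sym.
apply/exists_inP/orP => [[x]|[]]; rewrite ?edge_ofE.
- by rewrite !inE => /orP[] /eqP ->; rewrite inF => ->; [left | right].
- by rewrite -inF => df; exists d; rewrite ?inE ?eqxx.
- by rewrite -inF => df; exists (t d); rewrite ?inE ?eqxx ?orbT.
Qed.

Lemma kauffman_stateP K : reflect
  [/\ forall v, v \in vertices G -> #|v :&: K| = 1%N,
      forall f, f \in faces G -> ~~ adjacent f e -> #|f :&: K| = 1%N
    & forall f, f \in faces G -> adjacent f e -> #|f :&: K| = 0%N]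
  (is_kauffman_state e K).
Proof.
apply: (iffP and3P) => -[vK fK eK]; split.
- by move=> v vV; apply/eqP; apply: (forall_inP vK).
- by move=> f fF fN; apply/eqP; apply: (implyP (forall_inP fK f fF)).
- by move=> f fF fA; apply/eqP; rewrite cards_eq0; apply: (implyP (forall_inP eK f fF)).
- by apply/forall_inP => v /vK ->.
- by apply/forall_inP => f fF; apply/implyP => fN; rewrite fK.
- by apply/forall_inP => f fF; apply/implyP => fA; rewrite -cards_eq0 eK.
Qed.

Definition ind K a : int := (a \in K)%:R.

Lemma sum_ind (O : {set half_edge G}) K : \sum_(a in O) ind K a = #|O :&: K|%:R.
Proof.
rewrite -sum1_card natr_sum big_mkcond [RHS]big_mkcond; apply: eq_bigr => a _.
by rewrite inE /ind; case: (a \in O); case: (a \in K).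
Qed.

Lemma ind_inj K K' : ind K =1 ind K' -> K = K'.
Proof.
move=> E; apply/setP => a; have := E a.
by rewrite /ind; case: (a \in K); case: (a \in K').
Qed.

(** A coboundary sums to zero around each vertex and each face, so [K] and [K'] have as many angles
    in each. *)
Lemma coboundary_state K K' (m : {set half_edge G} -> int) :
    (forall a, ind K' a = ind K a + (m (ed (s a)) - m (ed a))) ->
  is_kauffman_state e K -> is_kauffman_state e K'.
Proof.
move=> K'E /kauffman_stateP[vK fK eK].
have sum0 O : O \in vertices G \/ O \in faces G -> #|O :&: K'| = #|O :&: K|.
  move=> OVF; apply/eqP; rewrite -(eqr_nat int) -!sum_ind.
  under eq_bigr => a _ do rewrite K'E.
  rewrite big_split sumrB /= -[X in _ == X]addr0 (inj_eq (addrI _)) subr_eq0.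
  case: OVF => OP; first by rewrite (sum_porbit_shift (fun a => m (ed a)) OP).
  rewrite -(sum_porbit_shift (fun a => m (ed (s a))) OP).
  by apply/eqP/eq_bigr => a _; rewrite edge_of_cw_face.
by apply/kauffman_stateP; split=> [v vV|f fF|f fF]; rewrite sum0;
  by [left | right | apply: vK | apply: fK | apply: eK].
Qed.

(** The bound says that the shifted indicator takes only the values 0 and 1, so it is again that of
    a set. *)
Lemma state_of_height K (m : {set half_edge G} -> int) :
    is_kauffman_state e K ->
    (forall a, 0 <= ind K a + (m (ed (s a)) - m (ed a)) <= 1) ->
  exists2 K', is_kauffman_state e K' &
    forall a, ind K' a = ind K a + (m (ed (s a)) - m (ed a)).
Proof.
move=> KS mK; pose K' := [set a | ind K a + (m (ed (s a)) - m (ed a)) == 1].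
have K'E a : ind K' a = ind K a + (m (ed (s a)) - m (ed a)).
  have := mK a; rewrite [LHS]/ind inE; case: eqP => [-> //|N1] le01.
  by rewrite mulr0n; lia.
by exists K' => //; apply: coboundary_state KS.
Qed.

(* [m e'] is the net number of counterclockwise moves along [e'] on the way
   from [K] to [K']. *)
Definition is_height K K' (m : {set half_edge G} -> int) :=
  [/\ m e = 0, forall f, f \notin edges G -> m f = 0
    & forall a, ind K' a = ind K a + (m (ed (s a)) - m (ed a))].

Lemma height_comp K K1 K2 m m' : is_height K K1 m -> is_height K1 K2 m' ->
  is_height K K2 (fun f => m f + m' f).
Proof.
move=> [me mN mE] [m'e m'N m'E]; split; first by rewrite me m'e.
  by move=> f fN; rewrite mN ?m'N.
by move=> a; rewrite m'E mE; lia.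
Qed.

Lemma state_vertex_unique K a b : is_kauffman_state e K ->
  a \in K -> b \in K -> vx a = vx b -> a = b.
Proof.
move=> /kauffman_stateP[vK _ _] aK bK E.
have /eqP/cards1P[c Ec] := vK _ (porbit_in s a).
have : a \in [set c] by rewrite -Ec inE porbit_id.
have : b \in [set c] by rewrite -Ec inE bK -/(vx a) E porbit_id.
by rewrite !inE => /eqP -> /eqP ->.
Qed.

Lemma state_face_unique K a b : is_kauffman_state e K ->
  a \in K -> b \in K -> fc a = fc b -> a = b.
Proof.
move=> /kauffman_stateP[_ fK eK] aK bK E.
have a_in : a \in fc a :&: K by rewrite inE porbit_id.
have b_in : b \in fc a :&: K by rewrite inE E porbit_id.
have : (#|fc a :&: K| <= 1)%N.
  by case: (boolP (adjacent (fc a) e)) => fA; [rewrite eK ?porbit_in | rewrite fK ?porbit_in].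
by move/card_le1_eqP; apply.
Qed.

Lemma next_cw_neq a : s a != a.
Proof.
apply/eqP => sa; have := next_cw_degree4 a.
have -> : porbit s a = [set a]; last by rewrite cards1.
apply/setP => x; rewrite inE; apply/porbitP/eqP => [[i ->]|->].
  by elim: i => [|i IH]; rewrite ?perm1 // expgSr permM IH.
by exists 0%N; rewrite perm1.
Qed.

Lemma edge_of_next_cw_neq a : ed (s a) != ed a.
Proof.
rewrite edge_of_eq negb_or next_cw_neq; apply: contraNneq (loopless a) => <-.
exact: (mem_porbit s 1).
Qed.

(** The angles moved into are free beforehand: each shares its vertex with an angle of [K] with
    source [e'], and a vertex has only one angle in [K]. *)
Lemma ind_ccw_move K e' a : is_kauffman_state e K -> angles_with_source e' \subset K ->
  ind (ccw_move e' K) a = ind K a + ((ed (s a) == e')%:R - (ed a == e')%:R).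
Proof.
move=> KS /subsetP src; have srcP b : ed b = e' -> b \in K.
  by move=> Eb; apply: src; rewrite inE Eb.
have shiftE : (a \in [set (s^-1)%g b | b in angles_with_source e']) = (ed (s a) == e').
  apply/imsetP/eqP => [[b] | E]; first by rewrite inE => /eqP <- ->; rewrite permKV.
  by exists (s a); rewrite ?inE ?E ?permK.
rewrite /ind !inE shiftE; have [Ea|aN] := eqVneq (ed a) e'.
  by rewrite (srcP a Ea) /= -Ea (negPf (edge_of_next_cw_neq a)).
have [Esa|_] := eqVneq (ed (s a)) e'; last by rewrite orbF subrr addr0.
rewrite orbT subr0 [in a \in K](_ : (a \in K) = false) ?add0r //.
apply/negP => aK; have /eqP := next_cw_neq a; apply.
by apply: (state_vertex_unique KS) => //; [apply: srcP | apply: vertex_of_next_cw].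
Qed.

Lemma ccw_move_height K e' : is_kauffman_state e K -> e' \in edges G -> e' != e ->
    angles_with_source e' \subset K ->
  is_kauffman_state e (ccw_move e' K) /\
  is_height K (ccw_move e' K) (fun f => (f == e')%:R).
Proof.
move=> KS e'E e'N src; have mE a := ind_ccw_move a KS src.
split; first exact: (coboundary_state (m := fun f => (f == e')%:R) mE KS).
split=> [|f fN|//] /=; first by rewrite eq_sym (negPf e'N).
by case: eqP => // E; rewrite E e'E in fN.
Qed.

(** * Existence of states, heights and moves *)

Hypothesis eE : e \in edges G.

Lemma card_nonadjacent_faces :
  (#|[set f in faces G | ~~ adjacent f e]| = #|vertices G|)%N.
Proof.
have /imsetP[d _ eEd] := eE.
have -> : [set f in faces G | ~~ adjacent f e] = faces G :\: [set fc d; fc (t d)].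
  by apply/setP => f; rewrite !inE andbC; apply: andb_id2r => fF; rewrite (adjacentE eEd).
have := cardsID [set fc d; fc (t d)] (faces G); rewrite card_faces.
rewrite (setIidPr _); last by apply/subsetP => f; rewrite !inE => /orP[] /eqP ->; apply: porbit_in.
by rewrite cards2 eq_sym face_of_other_half_neq; lia.
Qed.

(** Hall's theorem matches the faces away from [e] to vertices; equal numbers make the matching
    perfect. *)
Lemma kauffman_state_exists : prime_diagram G -> exists K, is_kauffman_state e K.
Proof.
move=> prG; pose inner_face : finType := {f | (f \in faces G) && ~~ adjacent f e}.
pose r (f : inner_face) v := [exists a, (fc a == val f) && (vx a == v)].
have cardF : #|{: inner_face}| = #|vertices G|.
  by rewrite card_sig -card_nonadjacent_faces; apply: eq_card => f; rewrite !inE.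
have [X | m m_inj mP] := @hall_matching _ _ r.
  set N := [set v | _]; pose Phi := [set val f | f : inner_face in X].
  have cardX : #|X| = #|Phi| by rewrite card_imset //; apply: val_inj.
  have NV : N \subset vertices G.
    apply/subsetP => v; rewrite inE => /exists_inP[f _ /existsP[a /andP[_ /eqP <-]]].
    exact: porbit_in.
  have closed b : fc b \in Phi -> vx b \in N.
    case/imsetP => f fX Ef; rewrite inE; apply/exists_inP; exists f => //.
    by apply/existsP; exists b; rewrite Ef !eqxx.
  have [->|N_V] := eqVneq N (vertices G); first by rewrite -cardF max_card.
  rewrite cardX; have [N0|N_0] := eqVneq N set0.
    rewrite N0 cards0 leqn0 cards_eq0; apply: contraT => /set0Pn[f fP].
    have /imsetP[f' _ Ef] := fP; have /andP[/imsetP[b _ f'b] _] := valP f'.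
    by have := closed b; rewrite /face_of -f'b -Ef N0 inE => /(_ fP).
  apply/ltnW/prime_faces_lt_vertices => //.
  by apply/subsetP => _ /imsetP[[f fP] _ ->]; have /andP[] := fP.
have /fin_all_exists[ang angP] : forall f : inner_face, exists a, fc a = val f /\ vx a = m f.
  by move=> f; have /existsP[a /andP[/eqP ? /eqP ?]] := mP f; exists a.
have mV : [set m f | f : inner_face] = vertices G.
  have cm : #|[set m f | f : inner_face]| = #|vertices G|.
    by rewrite -cardF card_imset //; apply: eq_card.
  apply/eqP; rewrite eqEcard cm leqnn andbT.
  by apply/subsetP => _ /imsetP[f _ ->]; case: (angP f) => _ <-; apply: porbit_in.
exists [set ang f | f : inner_face]; apply/kauffman_stateP; split.
- move=> v vV; have /imsetP[f _ Ev] : v \in [set m f | f : inner_face] by rewrite mV.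
  apply/eqP/cards1P; exists (ang f); apply/setP => a; rewrite !inE (mem_porbits _ vV).
  apply/andP/eqP => [[/eqP av /imsetP[f' _ Ea]] | ->]; last first.
    by split; [case: (angP f) => _; rewrite Ev => <- | apply: imset_f].
  rewrite Ea; congr ang; apply: m_inj; rewrite -Ev -av Ea.
  by case: (angP f') => _ <-.
- move=> f fF fN; have fP : (f \in faces G) && ~~ adjacent f e by rewrite fF.
  apply/eqP/cards1P; exists (ang (Sub f fP)); apply/setP => a.
  rewrite !inE (mem_porbits _ fF).
  apply/andP/eqP => [[/eqP af /imsetP[f' _ Ea]] | ->]; last first.
    by split; [apply/eqP; case: (angP (Sub f fP)) | apply: imset_f].
  rewrite Ea; congr ang; apply: val_inj; rewrite /= -af Ea.
  by case: (angP f') => <-.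
- move=> f fF fA; apply/eqP; rewrite cards_eq0; apply: contraT => /set0Pn[a].
  rewrite inE (mem_porbits _ fF) => /andP[/eqP af /imsetP[f' _ Ea]].
  have := valP f'; case: (angP f') => /= <- _.
  by rewrite -Ea /face_of af fA andbF.
Qed.

(** The difference of the indicators sums to zero around every vertex and face, hence has a rational
    potential; normalised at [e], it is integral because its increments are integers and the diagram
    is connected. *)
Lemma height_exists K K' : is_kauffman_state e K -> is_kauffman_state e K' ->
  exists m, is_height K K' m.
Proof.
move=> /kauffman_stateP[vK fK eK] /kauffman_stateP[vK' fK' eK'].
pose y a : rat := (ind K' a - ind K a)%:~R.
have sumy O : #|O :&: K| = #|O :&: K'| -> \sum_(a in O) y a = 0.
  by move=> E; rewrite -[LHS]raddf_sum sumrB !sum_ind E subrr.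
have [v vV | f fF | x xE] := @edge_potential G y; first by apply: sumy; rewrite vK ?vK'.
  by apply: sumy; case: (boolP (adjacent f e)) => fA; [rewrite eK ?eK' | rewrite fK ?fK'].
have /imsetP[d _ eEd] := eE.
have xint a : x (ed a) - x e \is a Num.int.
  have xc := @constant_on_edges G _ (fun f => x f - x e \is a Num.int) _ a d.
  rewrite xc => [|b]; first by rewrite /edge_of -eEd subrr rpred0.
  have -> : x (ed (s b)) - x e = y b + (x (ed b) - x e) by rewrite xE; ring.
  by rewrite rpredDl // intr_int.
exists (fun f => if f \in edges G then Num.floor (x f - x e) else 0); split.
- by rewrite eE subrr floor0.
- by move=> f /negPf ->.
move=> a; rewrite !porbit_in; apply: (@intr_inj rat).
by rewrite rmorphD rmorphB /= !floorK //; have := xE a; rewrite /y rmorphB /=; lra.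
Qed.

(** Two heights differ by a constant on the edges, which the value at [e] fixes; outside the edges
    both vanish. *)
Lemma height_unique K K' m m' : is_height K K' m -> is_height K K' m' -> m =1 m'.
Proof.
move=> [me mN mE] [m'e m'N m'E] f.
case: (boolP (f \in edges G)) => [/imsetP[a _ ->]|fN]; last by rewrite mN ?m'N.
have /imsetP[d _ /esym dE] := eE.
have : m (ed a) - m' (ed a) = m (ed d) - m' (ed d).
  apply: (constant_on_edges (x := fun f => m f - m' f)) => b.
  by have := mE b; have := m'E b; lia.
by rewrite [ed d]dE me m'e subrr => /eqP; rewrite subr_eq0 => /eqP.
Qed.

(* Some edge of maximal height admits a move: otherwise each of them is the
   source of an angle outside [K], whose target edge has maximal height too.
   Following these angles gives a closed curve with the vertices it passes on
   one side and the faces on the other; it crosses no edge of the matching [K],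
   which contradicts the strict inequality of [prime_faces_lt_vertices]. *)
Lemma move_exists K K' m e1 : prime_diagram G ->
    is_kauffman_state e K -> is_height K K' m -> e1 \in edges G -> 0 < m e1 ->
  exists e', [/\ e' \in edges G, e' != e, angles_with_source e' \subset K & 0 < m e'].
Proof.
move=> prG KS [me _ mE] e1E m1.
(* The edges of maximal height; this maximum is positive, so [e] is not among them. *)
pose X := [set f in edges G | [forall f' in edges G, m f' <= m f]].
have mX f : f \in X -> 0 < m f.
  by rewrite inE => /andP[_ /forall_inP/(_ _ e1E)]; apply: lt_le_trans.
have eX : e \notin X by apply/negP => /mX; rewrite me ltxx.
have X0 : X != set0.
  apply/set0Pn; case: (@Order.TotalTheory.arg_maxP _ _ _ e1 (mem (edges G)) m e1E) => f fE fmax.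
  by exists f; rewrite inE; apply/andP; split=> //; apply/forall_inP.
case: (boolP [exists f in X, angles_with_source f \subset K]).
  case/exists_inP => f fX src; exists f; split=> //; last exact: mX.
    by move: fX; rewrite inE => /andP[].
  by apply: contraNneq eX => <-.
rewrite negb_exists_in => /forall_inP noX; exfalso.
have /imsetP[d _ eEd] := eE.
(* An angle outside [K] with source [f]; the default [d] is never reached for [f] in [X]. *)
pose sel f := odflt d [pick a | (ed a == f) && (a \notin K)].
have selP f : f \in X -> ed (sel f) = f /\ sel f \notin K.
  move=> /noX /subsetPn[a]; rewrite inE => af aK; rewrite /sel.
  by case: pickP => [b /andP[/eqP]|/(_ a)] //=; rewrite af aK.
pose next f := ed (s (sel f)).
(* Across an angle outside [K] the height cannot decrease, so maximality passes from source to
   target. *)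
have nextX f : f \in X -> next f \in X.
  move=> fX; have [Ef fK] := selP _ fX; move: (fX); rewrite !inE porbit_in /=.
  case/andP => _ /forall_inP fmax; apply/forall_inP => f' /fmax le.
  apply: le_trans le _; have := mE (sel f); rewrite /next Ef /ind (negPf fK).
  by case: (_ \in K'); lia.
(* A minimal nonempty stable set is permuted by [next], so the chosen angles close up. *)
pose stable Y := [&& Y != set0, Y \subset X & next @: Y \subset Y].
have [|Y Ymin _] := @minset_exists _ stable X.
  by rewrite /stable X0 subxx; apply/subsetP => _ /imsetP[f /nextX ? ->].
have /and3P[Y0 /subsetP YX nextY] := minsetp Ymin.
have imY : next @: Y = Y.
  apply: (minsetinf Ymin) => //; apply/and3P; split.
  - by have /set0Pn[f fY] := Y0; apply/set0Pn; exists (next f); apply: imset_f.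
  - by apply: subset_trans nextY _; apply/subsetP.
  - exact: imsetS.
have next_inj : {in Y &, injective next} by apply/imset_injP; rewrite imY.
pose onY a := (ed a \in Y) && (a == sel (ed a)).
pose c a : rat := (onY a)%:R.
have onY_sel f : f \in Y -> onY (sel f).
  by move=> fY; have [Ef _] := selP _ (YX _ fY); rewrite /onY Ef fY eqxx.
have onY_next a : onY a -> ed (s a) = next (ed a).
  by case/andP => _ /eqP Ea; rewrite /next -Ea.
have sumc (P : pred (half_edge G)) a0 : P a0 -> onY a0 -> (forall a, P a -> onY a -> a = a0) ->
    \sum_(a | P a) c a = 1.
  move=> Pa0 Ya0 uniq; rewrite (bigD1 a0) //= /c Ya0 big1 ?addr0 // => a /andP[Pa aN].
  by case: (boolP (onY a)) => // /(uniq _ Pa) E; rewrite E eqxx in aN.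
have sumc0 (P : pred (half_edge G)) : (forall a, P a -> ~~ onY a) -> \sum_(a | P a) c a = 0.
  by move=> PN; apply: big1 => a /PN /negPf Ea; rewrite /c Ea.
(* [c] is conserved: each edge of [Y] is once the source and once the target of a chosen angle. *)
have [f fE | rv [rf cE]] := @cell_potential G c.
  case: (boolP (f \in Y)) => fY; last first.
    rewrite !sumc0 // => a /eqP Ea; apply: contraNN fY => Ya.
      by case/andP: Ya; rewrite Ea.
    rewrite -Ea onY_next //; apply: (subsetP nextY); apply: imset_f.
    by case/andP: Ya.
  have := fY; rewrite -{1}imY => /imsetP[f' f'Y Ef].
  have [Ef' _] := selP _ (YX _ f'Y).
  rewrite (sumc _ (sel f')) ?(sumc _ (sel f)) ?onY_sel //.
  - by have [-> _] := selP _ (YX _ fY).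
  - by move=> a /eqP <- /andP[_ /eqP].
  - by rewrite Ef.
  move=> a /eqP Ea Ya; have /andP[aY /eqP ->] := Ya; congr sel.
  by apply: next_inj => //; rewrite -onY_next // Ea.
have cK a : a \in K -> c a = 0.
  move=> aK; rewrite /c; case: (boolP (onY a)) => // /andP[aY /eqP Ea].
  by have [_] := selP _ (YX _ aY); rewrite -Ea aK.
have c_e a : ed a = e -> c a = 0.
  by move=> Ea; rewrite /c /onY Ea (contraNF (YX e)).
have c_ge0 a : 0 <= c a by rewrite ler0n.
(* As [c] is nonnegative, [rf] never exceeds the maximum of [rv], and a face reaching it has all its
   vertices in [S]. *)
case: (@Order.TotalTheory.arg_maxP _ _ _ d predT (rv \o vx) isT) => a0 _ /= a0max.
set M := rv (vx a0) in a0max.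
pose S := [set v in vertices G | rv v == M].
pose Phi := [set f in faces G | rf f == M].
have inS a : (vx a \in S) = (rv (vx a) == M) by rewrite inE porbit_in.
have inPhi a : (fc a \in Phi) = (rf (fc a) == M) by rewrite inE porbit_in.
have closed b : fc b \in Phi -> vx b \in S.
  rewrite inS inPhi => /eqP fM; have := a0max b isT; have := c_ge0 b.
  by rewrite cE fM => *; apply/eqP; lra.
have SV : S \subset vertices G by apply/subsetP => v; rewrite inE => /andP[].
have S0 : S != set0 by apply/set0Pn; exists (vx a0); rewrite inS.
have /kauffman_stateP[vK fK _] := KS.
(* If [rv] is constant, the face of [sel f] has an angle where [c] vanishes, in [K] or with source
   [e]; so [rf] is [M] there and [c (sel f)] is 0. *)
have [SE|SN] := eqVneq S (vertices G).
  have rvM a : rv (vx a) = M by apply/eqP; rewrite -inS SE porbit_in.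
  have /set0Pn[f fY] := Y0.
  have : c (sel f) = 0; last by rewrite /c onY_sel.
  rewrite cE rvM; apply/eqP; rewrite subr_eq0 eq_sym; apply/eqP.
  have fF : fc (sel f) \in faces G by apply: porbit_in.
  have faceM a : a \in fc (sel f) -> c a = 0 -> rf (fc (sel f)) = M.
    rewrite (mem_porbits _ fF) -/(fc a) => /eqP <- ca0.
    by have := cE a; rewrite ca0 rvM => *; lra.
  case: (boolP (adjacent (fc (sel f)) e)) => fA.
    have /exists_inP[a ae af] := fA; apply: (faceM a) => //; apply: c_e.
    by apply/eqP; rewrite -(mem_porbits a eE).
  have /eqP/cards1P[a Ea] := fK _ fF fA.
  have /setIP[af aK] : a \in fc (sel f) :&: K by rewrite Ea set11.
  by apply: (faceM a) => //; apply: cK.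
have PF : Phi \subset faces G by apply/subsetP => f; rewrite inE => /andP[].
have := prime_faces_lt_vertices prG SV S0 SN PF closed.
pose mk v := odflt d [pick a in v :&: K].
(* On the angle of [K] at [v], [c] vanishes, so its face lies in [Phi]; distinct vertices give
   distinct faces. *)
have mkP v : v \in S -> [/\ vx (mk v) = v, mk v \in K & fc (mk v) \in Phi].
  move=> vS; have vV := subsetP SV _ vS; have /eqP/cards1P[a Ea] := vK _ vV.
  rewrite /mk; case: pickP => [b|/(_ a)] /=; last by rewrite Ea set11.
  rewrite inE (mem_porbits _ vV) -/(vx b) => /andP[/eqP bv bK]; split=> //.
  rewrite inPhi; move: vS; rewrite -bv inS => /eqP <-.
  by rewrite eq_sym -subr_eq0 -cE cK.
rewrite ltnNge => /negP[].
have fc_inj : {in S &, injective (fc \o mk)}.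
  move=> v w /mkP[Ev vmK _] /mkP[Ew wmK _] /= E.
  by rewrite -Ev -Ew (state_face_unique KS vmK wmK E).
rewrite -(card_in_imset fc_inj); apply: subset_leq_card.
by apply/subsetP => _ /imsetP[v /mkP[_ _ ?] ->].
Qed.

End KauffmanStates.

(** * Reachability as comparison of heights *)

Theorem corollary4p9 (G : link_diagram) (e : {set half_edge G}) :
  prime_diagram G -> e \in edges G ->
  graded_distributive_lattice_digraph (@Kauff G e).
Proof.
move=> prG eE; have [K0 K0S] := kauffman_state_exists eE prG.
have /fin_all_exists[H HP] : forall K : kauffman_state e,
    exists m, is_height e K0 (val K) m.
  by move=> K; apply: height_exists (valP K).
have H_bound K a : (0 <= ind K0 a + (H K (edge_of (next_cw G a)) - H K (edge_of a)) <= 1)%R.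
  by case: (HP K) => _ _ <-; rewrite /ind; case: (_ \in _).
(* [op] will be min or max; both preserve the bound on the increment across each angle. *)
have combine (op : int -> int -> int) (K K' : kauffman_state e) :
    op 0%R 0%R = 0%R ->
    (forall x x' y y' l : int, (0 <= l + (x' - x) <= 1)%R -> (0 <= l + (y' - y) <= 1)%R ->
       (0 <= l + (op x' y' - op x y) <= 1)%R) ->
    exists L, forall f, H L f = op (H K f) (H K' f).
  move=> op0 op_bound; have [|L LS LE] := @state_of_height G e K0
    (fun f => op (H K f) (H K' f)) K0S.
    by move=> a; exact: op_bound (H_bound K a) (H_bound K' a).
  exists (Sub L LS).
  apply: (height_unique (m' := fun f => op (H K f) (H K' f)) eE (HP (Sub L LS))); split=> //.
    by case: (HP K) (HP K') => -> _ _ [-> _ _].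
  by move=> f' fN; case: (HP K) (HP K') => _ -> // _ [_ -> // _].
have H_inj K K' : H K =1 H K' -> K = K'.
  move=> E; apply/val_inj/ind_inj => a.
  by case: (HP K) (HP K') => _ _ -> [_ _ ->]; rewrite !E.
have H_move K K' : Kauff K K' -> exists2 e', e' \in edges G &
    forall f, H K' f = (H K f + (f == e')%:R)%R.
  case/exists_inP => e' e'E /and3P[e'N src /eqP E]; exists e' => //.
  have [_ mv] := ccw_move_height (valP K) e'E e'N src.
  apply: (height_unique (m' := fun f => (H K f + (f == e')%:R)%R) eE (HP K')).
  by rewrite E; apply: height_comp mv.
split.
- by apply/card_gt0P; exists (Sub K0 K0S).
- have [||disp [L [h [h_bij hE]]]] := @distr_lattice_of_heights _ _ H H_inj.
  + by move=> K K'; apply: combine => //; lia.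
  + by move=> K K'; apply: combine => //; lia.
  exists disp, L, h; split=> // K K'; rewrite hE; apply/idP/forallP.
    case/connectP => l; elim: l K => [|K1 l IH] K /= => [_ -> // | /andP[mv pl] E f].
    apply: le_trans (IH _ pl E f); have [e' _ ->] := H_move _ _ mv.
    by rewrite lerDl ler0n.
  (* Induction on the total height still to be gained. *)
  have [n] := ubnP (absz (\sum_f (H K' f - H K f))%R).
  elim: n => // n IH in K * => lt_n leH.
  have [e1 e1N | eqH] := pickP (fun f => H K f != H K' f); last first.
    by rewrite (H_inj K K') // => f; apply/eqP/negbFE/eqH.
  have hK : is_height e (val K) (val K') (fun f => H K' f - H K f)%R.
    case: (HP K) (HP K') => [me mN mE] [m'e m'N m'E]; split.
    + by rewrite me m'e.
    + by move=> f fN; rewrite mN ?m'N.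
    + by move=> a; rewrite m'E mE; lia.
  have e1E : e1 \in edges G.
    by apply: contraNT e1N => fN; case: (HP K) (HP K') => _ -> // _ [_ -> // _].
  have e1_gt0 : (0 < H K' e1 - H K e1)%R by have := leH e1; lia.
  (* The move is made where [K'] is strictly higher, so the new state stays below [K']. *)
  have [e' [e'E e'N src e'_gt0]] := move_exists eE prG (valP K) hK e1E e1_gt0.
  have [mvS _] := ccw_move_height (valP K) e'E e'N src.
  pose K1 : kauffman_state e := Sub (ccw_move e' (val K)) mvS.
  have mv : Kauff K K1 by apply/exists_inP; exists e'; rewrite ?e'N ?src /=.
  have H1 f : H K1 f = (H K f + (f == e')%:R)%R.
    have [_ mvH] := ccw_move_height (valP K) e'E e'N src.
    exact: (height_unique eE (HP K1) (height_comp (HP K) mvH) f).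
  have leH1 f : (H K1 f <= H K' f)%O.
    by rewrite H1; have := leH f; case: eqP => [->|_] /=; lia.
  apply: connect_trans (connect1 mv) (IH K1 _ leH1).
  have sumE : (\sum_f (H K' f - H K f) = \sum_f (H K' f - H K1 f) + 1)%R.
    rewrite [X in (_ + X)%R](_ : _ = \sum_f (f == e')%:R)%R.
      by rewrite -big_split; apply: eq_bigr => f _; rewrite H1 /=; ring.
    rewrite (bigD1 e') //= eqxx big1 ?addr0 // => f /negPf -> //.
  have : (0 <= \sum_f (H K' f - H K1 f))%R by apply: sumr_ge0 => f _; rewrite subr_ge0.
  by move: lt_n; rewrite sumE; lia.
(* Non-edges have height 0 and a move raises one edge by 1, so the total height is a rank. *)
exists (fun K => \sum_f H K f)%R => K K' /H_move[e' _ HE].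
rewrite (eq_bigr _ (fun f _ => HE f)) big_split /=; congr (_ + _)%R.
by rewrite (bigD1 e') //= eqxx big1 ?addr0 // => f /negPf ->.
Qed.
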